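(* Let $S$ be an $E$-dense semigroup whose set of idempotents $E$ is a semilattice, and let $X$ be a locally free, transitive, graded $E$-dense $S$-act with grading $p$. Then there exists $e\in E$ such that $X\cong Se\cong L_e$, where $Se$ is the orbit of $e$ in the $E$-dense $S$-act $S$ with the Wagner-Preston action. Conversely, if $e\in E$ then the orbit $Se$ of $e$ in the $E$-dense $S$-act $S$ (with the Wagner-Preston action) is a locally free, transitive, graded $E$-dense $S$-act.
   Context: For a semigroup $S$, $E=E(S)$ is its set of idempotents and $W(s)=\{s'\in S\mid s'ss'=s'\}$ is the set of weak inverses of $s\in S$. $S$ is $E$-dense if for every $s\in S$ there are $t,u\in S$ with $ts\in E$ and $su\in E$ (equivalently $W(s)\neq\emptyset$ for all $s$). $E$ is a semilattice if it is a subsemigroup and its elements commute. Partial order on $S$: $s\le t$ iff $s=t$ or there are $e,f\in E$ with $s=te=ft$. For $A\subseteq S$, $A\omega=\{s\in S\mid a\le s\text{ for some }a\in A\}$. For $e\in E$, $[e]=\{s\in S\mid s\le e\}=eE$. An $E$-dense $S$-act is a nonempty set $X$ with a partial map $S\times X\to X$, $(s,x)\mapsto sx$, such that $(st)x$ exists iff $tx$ and $s(tx)$ exist, and then $(st)x=s(tx)$; which is cancellative (if $sx,sy$ exist and $sx=sy$ then $x=y$) and reflexive (if $sx$ exists then there is $s'\in W(s)$ such that $s'(sx)$ exists). Write $D_s=D_s^X=\{x\in X\mid sx\text{ exists}\}$, $D^x=\{s\in S\mid sx\text{ exists}\}$, $S_x=\{s\in D^x\mid sx=x\}$ and $E^x=E\cap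 D^x$. The orbit of $x$ is $Sx=\{sx\mid s\in D^x\}\cup\{x\}$, an $E$-dense $S$-act with the action restricted from $X$. $X$ is transitive if for all $x,y\in X$ there is $s\in D^x$ with $y=sx$. $X$ is locally free if $S_x=(E^x)\omega$ for all $x\in X$. $X$ is graded, with grading $p$, if $p:X\to E$ is a function with $D_e=p^{-1}([e])$ for all $e\in E$. An $S$-map $f:X\to Y$ is a function such that for all $s\in S$, $x\in D^X_s$ iff $f(x)\in D^Y_s$, and then $f(sx)=sf(x)$; $\cong$ means there is a bijective $S$-map. The Wagner-Preston action of $S$ on itself: $sx$ (the product in $S$) is defined as an action exactly when $x\in D_s=\{x\in S\mid \exists s'\in W(s),\ x=s'sx\}$; this makes $S$ an $E$-dense $S$-act. $L_e$ is the Green's $\mathcal L$-class of $e$ (where $a\,\mathcal L\,b$ iff $S^1a=S^1b$), regarded as an $E$-dense $S$-act via the restriction of the Wagner-Preston action. *)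

(* Defs.v *)
From mathcomp Require Import all_boot.
From mathcomp Require Import boolp classical_sets.

Set Implicit Arguments.
Unset Strict Implicit.
Unset Printing Implicit Defensive.

Local Open Scope classical_set_scope.
Local Open Scope group_scope.

(* [semigroupType] extends [choiceType]; this is no restriction, since
   [boolp] endows every type with a choice structure. *)

Definition idempotents (S : semigroupType) : set S := [set e | e * e = e].
Arguments idempotents : clear implicits.

Definition weak_inverses (S : semigroupType) (s : S) : set S :=
  [set s' | s' * s * s' = s'].

Definition E_dense (S : semigroupType) : Prop :=
  forall s : S, exists t u : S,
    idempotents S (t * s) /\ idempotents S (s * u).
Arguments E_dense : clear implicits.

Definition semilattice_idempotents (S : semigroupType) : Prop :=
  forall e f : S, idempotents S e -> idempotents S f ->
    idempotents S (e * f) /\ e * f = f * e.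
Arguments semilattice_idempotents : clear implicits.

Definition sle (S : semigroupType) (s t : S) : Prop :=
  s = t \/ exists e f : S,
    [/\ idempotents S e, idempotents S f, s = t * e & s = f * t].

Definition omega (S : semigroupType) (A : set S) : set S :=
  [set s | exists2 a, A a & sle a s].

Definition down (S : semigroupType) (e : S) : set S := [set s | sle s e].

(* [act s x = Some y] means that sx exists and equals y. *)
Record edense_act (S : semigroupType) := EDenseAct {
  carrier :> Type;
  act : S -> carrier -> option carrier;
  act_inhabited : inhabited carrier;
  (* (st)x exists iff tx and s(tx) exist, and then (st)x = s(tx) *)
  actM : forall s t x, act (s * t) x = obind (act s) (act t x);
  act_cancel : forall s x y z, act s x = Some z -> act s y = Some z -> x = y;
  act_reflexive : forall s x y, act s x = Some y ->
    exists2 s', weak_inverses s s' & isSome (act s' y)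
}.

Section Acts.
Variables (S : semigroupType) (X : edense_act S).

Definition dom (s : S) : set X := [set x | isSome (act s x)].

Definition dom_at (x : X) : set S := [set s | dom s x].

Definition stab (x : X) : set S := [set s | act s x = Some x].

Definition idem_at (x : X) : set S := idempotents S `&` dom_at x.

Definition orbit (x : X) : set X :=
  [set y | (exists s, act s x = Some y) \/ y = x].

Definition transitive_act : Prop := forall x y : X, exists s, act s x = Some y.

Definition locally_free : Prop := forall x : X, stab x = omega (idem_at x).

Definition is_grading (p : X -> S) : Prop :=
  (forall x, idempotents S (p x)) /\
  (forall e, idempotents S e -> dom e = p @^-1` down e).

Definition graded : Prop := exists p : X -> S, is_grading p.

End Acts.

Definition S_map (S : semigroupType) (X Y : edense_act S) (f : X -> Y) : Prop :=
  forall s x, (dom s x <-> dom s (f x)) /\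
    (forall y, act s x = Some y -> act s (f x) = Some (f y)).

Definition act_iso (S : semigroupType) (X Y : edense_act S) : Prop :=
  exists2 f : X -> Y, bijective f & S_map f.

Section SubAct.
Variables (S : semigroupType) (X : edense_act S) (A : set X).
Hypothesis A_nonempty : A !=set0.
Hypothesis A_closed : forall s x y, A x -> act s x = Some y -> A y.

(* By [A_closed], [insub] never fails here: sx exists in A iff it exists in X
   (see [sub_opE]). *)
Definition sub_op (s : S) (x : A) : option A := obind insub (act s (val x)).

Lemma sub_opE s (x : A) : omap val (sub_op s x) = act s (val x).
Proof.
rewrite /sub_op; case E: act => [y|] //=.
have Ay : y \in A by rewrite inE; apply: A_closed E; apply: set_valP.
by rewrite insubT.
Qed.

Let sub_opP s (x y : A) : sub_op s x = Some y <-> act s (val x) = Some (val y).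
Proof.
rewrite -sub_opE; split=> [->//|].
by case: sub_op => //= z [] /val_inj ->.
Qed.

Lemma sub_inhabited : inhabited A.
Proof. by case: A_nonempty => x Ax; split; exists x; rewrite inE. Qed.

Lemma sub_opM s t x : sub_op (s * t) x = obind (sub_op s) (sub_op t x).
Proof.
apply: (inj_omap val_inj); rewrite sub_opE actM -sub_opE.
by case: (sub_op t x) => //= y; rewrite sub_opE.
Qed.

Lemma sub_cancel s x y z : sub_op s x = Some z -> sub_op s y = Some z -> x = y.
Proof. by move=> /sub_opP h /sub_opP /(act_cancel h) /val_inj. Qed.

Lemma sub_reflexive s x y : sub_op s x = Some y ->
  exists2 s', weak_inverses s s' & isSome (sub_op s' y).
Proof.
move=> /sub_opP /act_reflexive [s' Ws']; rewrite -sub_opE.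
by case E: sub_op => // _; exists s' => //; rewrite E.
Qed.

Definition subact : edense_act S :=
  EDenseAct sub_inhabited sub_opM sub_cancel sub_reflexive.

End SubAct.

Section OrbitAct.
Variables (S : semigroupType) (X : edense_act S) (x : X).

Lemma orbit_nonempty : orbit x !=set0.
Proof. by exists x; right. Qed.

Lemma orbit_closed s y z : orbit x y -> act s y = Some z -> orbit x z.
Proof.
case=> [[t tx]|->] sy; left; last by exists s.
by exists (s * t); rewrite actM tx.
Qed.

Definition orbit_act : edense_act S := subact orbit_nonempty orbit_closed.

End OrbitAct.

Section WagnerPreston.
Variable S : semigroupType.
Hypothesis hE : semilattice_idempotents S.

Definition wp_dom (s : S) : set S :=
  [set x | exists2 s', weak_inverses s s' & x = s' * s * x].

Definition wp_op (s x : S) : option S :=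
  if x \in wp_dom s then Some (s * x) else None.

Lemma wp_opP s x y : wp_op s x = Some y <-> wp_dom s x /\ s * x = y.
Proof.
rewrite /wp_op; case: ifPn => [/set_mem h|/negP h]; split=> //.
- by case=> <-.
- by case=> _ ->.
- by case=> /mem_set.
Qed.

Let wl (s s' : S) : weak_inverses s s' -> idempotents S (s' * s).
Proof. by rewrite /weak_inverses /idempotents /= => h; rewrite mulgA h. Qed.

Let wr (s s' : S) : weak_inverses s s' -> idempotents S (s * s').
Proof. by rewrite /weak_inverses /idempotents /= => h; rewrite -mulgA (mulgA s') h. Qed.

Lemma wp_domM s t x : wp_dom (s * t) x <-> wp_dom t x /\ wp_dom s (t * x).
Proof.
split=> [[v /= hv hx]|[[t' ht ex] [s' hs etx]]].
  have hv' : v * s * t * v = v by rewrite -(mulgA v).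
  split.
    exists (v * s); last by rewrite -(mulgA v).
    by rewrite /weak_inverses /= mulgA hv'.
  exists (t * v); last by rewrite {1}hx !mulgA.
  by rewrite /weak_inverses /= -[in RHS]hv' !mulgA.
have hc : s' * s * (t * t') = t * t' * (s' * s) by case: (hE (wl hs) (wr ht)).
have ht' : t' * t * t' = t' := ht; have hs' : s' * s * s' = s' := hs.
exists (t' * s').
  rewrite /weak_inverses /=.
  have -> : t' * s' * (s * t) * (t' * s') = t' * (s' * s * (t * t')) * s'.
    by rewrite !mulgA.
  by rewrite hc !mulgA ht' -(mulgA t') -(mulgA t') hs'.
have -> : t' * s' * (s * t) * x = t' * (s' * s * (t * x)) by rewrite !mulgA.
by rewrite -etx mulgA.
Qed.

Lemma wp_opM s t x : wp_op (s * t) x = obind (wp_op s) (wp_op t x).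
Proof.
rewrite {1}/wp_op; case: ifPn => [/set_mem /wp_domM [h1 h2]|/negP h].
  by rewrite (wp_opP t x (t * x)).2 //= (wp_opP s _ (s * (t * x))).2 // mulgA.
case E: (wp_op t x) => [y|] //=; case F: (wp_op s y) => [z|] //.
case: h; apply/mem_set/wp_domM; move/wp_opP: E => [h1 ty].
by move/wp_opP: F => [h2 _]; rewrite ty.
Qed.

Lemma wp_cancel s x y z : wp_op s x = Some z -> wp_op s y = Some z -> x = y.
Proof.
move=> /wp_opP [[u hu ex] <-] /wp_opP [[v hv ey] sy].
have [_ hc] := hE (wl hu) (wl hv).
have e1 : u * s * y = x by rewrite -mulgA sy mulgA -ex.
have e2 : v * s * x = y by rewrite -mulgA -sy mulgA -ey.
by rewrite -e1 {1}ey mulgA hc -mulgA e1.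
Qed.

Lemma wp_reflexive s x y : wp_op s x = Some y ->
  exists2 s', weak_inverses s s' & isSome (wp_op s' y).
Proof.
move=> /wp_opP [[s' hs ex] <-]; exists s' => //.
have hs' : s' * s * s' = s' := hs.
rewrite /wp_op mem_set //; exists (s * s' * s).
  rewrite /weak_inverses /=.
  have -> : s * s' * s * s' * (s * s' * s) = s * (s' * s * s' * s * s') * s.
    by rewrite !mulgA.
  by rewrite !hs'.
have -> : s * s' * s * s' * (s * x) = s * (s' * s * s') * s * x by rewrite !mulgA.
by rewrite hs' -!mulgA (mulgA s') -ex.
Qed.

Definition wagner_preston (iS : inhabited S) : edense_act S :=
  EDenseAct iS wp_opM wp_cancel wp_reflexive.

(* The orbit Se; the semigroup is inhabited because it contains e. *)
Definition wp_orbit (e : S) : edense_act S :=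
  @orbit_act S (wagner_preston (inhabits e)) e.

(* S^1 a *)
Definition principal_left (a : S) : set S :=
  [set b | b = a \/ exists t, b = t * a].

Definition greenL (a b : S) : Prop := principal_left a = principal_left b.

Definition L_class (e : S) : set S := [set a | greenL a e].

Lemma L_class_nonempty e : L_class e !=set0.
Proof. by exists e. Qed.

Lemma L_class_closed e s x y : L_class e x -> wp_op s x = Some y -> L_class e y.
Proof.
move=> Lx /wp_opP [[s' hs ex] <-].
have Lx' : principal_left x = principal_left e := Lx.
rewrite /L_class /greenL /= -Lx'.
apply/seteqP; split=> b /= [->|[t ->]].
- by right; exists s.
- by right; exists (t * s); rewrite mulgA.
- by right; exists s'; rewrite mulgA.
- by right; exists (t * s'); rewrite {1}ex !mulgA.
Qed.

Definition L_act (e : S) : edense_act S :=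
  @subact S (wagner_preston (inhabits e)) (L_class e)
    (L_class_nonempty e) (@L_class_closed e).

End WagnerPreston.

(* Main.v *)
From mathcomp Require Import all_boot.
From mathcomp Require Import boolp classical_sets.
Require Import Defs.

(** A transitive act is determined up to isomorphism by the stabiliser of any
    one of its points, just like a transitive set of a group
    ([transitive_stab_iso]): [s x |-> s y] is a well-defined bijection as soon as
    [x] and [y] have the same stabiliser.  In a locally free act the stabiliser
    of [x] is in turn determined by the idempotents defined at [x], and when
    the act is graded by [p] these are the idempotents above [p x].  So a
    locally free, transitive, graded act is determined by the single idempotent
    [p x], and it remains to see that the orbit [Se] is an act of this kind in
    which the idempotents defined at [e] are those above [e].

    For this, [Se] and [L_e] are the same subset of the semigroup
    ([wp_orbit_L_class]), which also gives [Se] isomorphic to [L_e].  Hence each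
    point [x] of [Se] is a regular element: [x = x x' x] for some [x'].  The
    idempotent [x x'] is fixed under left multiplication by exactly the same
    elements of the semigroup as [x]; it therefore grades [Se] ([wp_idem_domP]),
    and it lies below every [s] that fixes [x] ([wp_stab_sub_omega]), which is
    the substantial half of local freeness. *)

Set Implicit Arguments.
Unset Strict Implicit.
Unset Printing Implicit Defensive.

Local Open Scope classical_set_scope.
Local Open Scope group_scope.

(** * Acts of a semigroup *)

Section ActTheory.
Variables (S : semigroupType) (X : edense_act S).
Implicit Types (s t e : S) (x y z : X).

Lemma domP s x : dom s x <-> exists y, act s x = Some y.
Proof.
rewrite /dom /=; case: act => [y|]; split=> //; first by exists y.
by case.
Qed.

Lemma act_comp s t x y : act t x = Some y -> act (s * t) x = act s y.
Proof. by move=> h; rewrite actM h. Qed.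

(** If [e x = y] then [e y = (e e) x = y], and cancellation gives [y = x]. *)
Lemma act_idempotent e x y : idempotents S e -> act e x = Some y -> y = x.
Proof.
move=> ee exy; apply: (act_cancel _ exy).
by rewrite -(act_comp e exy) ee.
Qed.

(** The weak inverse given by reflexivity undoes [s]: [s' s] is an idempotent
    defined at [x], so it fixes [x]. *)
Lemma act_weak_inverse s x y : act s x = Some y ->
  exists2 s', weak_inverses s s' & act s' y = Some x.
Proof.
move=> sx; have [s' hs'] := act_reflexive sx.
case E: act => [z|//] _; exists s' => //; rewrite E.
have s's : idempotents S (s' * s) by rewrite /idempotents /= mulgA hs'.
by congr Some; apply: act_idempotent s's _; rewrite (act_comp s' sx).
Qed.

(** This half of local freeness holds in every act: if [e = f s] fixes [x], then
    [f] takes [s x] to [x], and being idempotent it does not move [s x]. *)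
Lemma omega_idem_at_sub_stab x : omega (idem_at x) `<=` stab x.
Proof.
move=> s [e [ee /domP[y ex]] es].
have {}ex : act e x = Some x by rewrite ex (act_idempotent ee ex).
case: es => [<-//|[_ [f [_ ff _ ef]]]].
move: ex; rewrite {1}ef actM /stab /=.
by case: (act s x) => //= z fz; rewrite (act_idempotent ff fz).
Qed.

End ActTheory.

Section SubactTheory.
Variables (S : semigroupType) (X : edense_act S) (A : set X).
Hypotheses (A0 : A !=set0).
Hypothesis (Aclosed : forall s x y, A x -> act s x = Some y -> A y).
Let Y := subact A0 Aclosed.

Lemma act_subactP s (x y : Y) : act s x = Some y <-> act s (val x) = Some (val y).
Proof.
have E : omap val (act s x) = act s (val x) := sub_opE Aclosed s x.
split=> [sx|]; first by rewrite -E sx.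
by rewrite -E; case: act => //= z [/val_inj ->].
Qed.

Lemma dom_subact s (x : Y) : dom s x <-> dom s (val x).
Proof.
have E : omap val (act s x) = act s (val x) := sub_opE Aclosed s x.
by rewrite /dom /mkset -E; case: (act s x).
Qed.

Lemma idem_at_subact (x : Y) : idem_at x = idem_at (val x).
Proof. by apply/seteqP; split=> s [ss sx]; split=> //; apply/dom_subact. Qed.

Lemma stab_subact (x : Y) : stab x = stab (val x).
Proof. by apply/seteqP; split=> s /act_subactP. Qed.

End SubactTheory.

Section OrbitTheory.
Variables (S : semigroupType) (X : edense_act S).

(** The orbit contains [x] by definition; that some [s] fixes [x] makes [x],
    like every other point, reachable from [x]. *)
Lemma orbit_act_transitive (s : S) (x : X) :
  act s x = Some x -> transitive_act (orbit_act x).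
Proof.
move=> sx.
have reach (y : orbit_act x) : exists t, act t x = Some (val y).
  have : orbit x (val y) by exact: set_valP.
  by case=> [//|->]; exists s.
move=> y z; have [t ty] := reach y; have [u uz] := reach z.
have [t' _ t'y] := act_weak_inverse ty.
by exists (u * t'); apply/act_subactP; rewrite (act_comp u t'y).
Qed.

End OrbitTheory.

Lemma subact_iso_eq (S : semigroupType) (X : edense_act S) (A B : set X)
    (A0 : A !=set0) (B0 : B !=set0)
    (Ac : forall s x y, A x -> act s x = Some y -> A y)
    (Bc : forall s x y, B x -> act s x = Some y -> B y) :
  A = B -> act_iso (subact A0 Ac) (subact B0 Bc).
Proof.
move=> AB; move: AB B0 Bc => <- B0 Bc.
by exists id; [exists id|].
Qed.

(** * Transitive acts and stabilisers *)

Section SameStabiliser.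
Variables (S : semigroupType) (X Y : edense_act S) (x : X) (y : Y).
Hypotheses (trX : transitive_act X) (sub_stab : stab x `<=` stab y).

(** Some [t] brings [s x] back to [x]; then [t s] fixes [x], hence [y]. *)
Lemma act_transfer s z : act s x = Some z -> exists w, act s y = Some w.
Proof.
move=> sx; have [t tz] := trX z x.
have /sub_stab : stab x (t * s) by rewrite /stab /= (act_comp t sx).
by rewrite /stab /= actM; case: (act s y) => // w _; exists w.
Qed.

(** If [t] brings the common value [s x = u x] back to [x], then [t] brings both
    [s y] and [u y] to [y]. *)
Lemma act_transfer_eq s u z :
  act s x = Some z -> act u x = Some z -> act s y = act u y.
Proof.
move=> sx ux; have [t tz] := trX z x.
have [v sy] := act_transfer sx; have [w uy] := act_transfer ux.
have /sub_stab : stab x (t * s) by rewrite /stab /= (act_comp t sx).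
have /sub_stab : stab x (t * u) by rewrite /stab /= (act_comp t ux).
rewrite /stab /= (act_comp t sy) (act_comp t uy) sy uy => tw tv.
by rewrite (act_cancel tv tw).
Qed.

End SameStabiliser.

(** The transfers [s x |-> s y] and [s y |-> s x] are inverse to each other.
    They need the inclusion of stabilisers in opposite directions, and the
    second one shows that an element defined at the image of a point is defined
    at the point itself. *)
Lemma transitive_stab_iso (S : semigroupType) (X Y : edense_act S)
    (x : X) (y : Y) :
  transitive_act X -> transitive_act Y -> stab x = stab y -> act_iso X Y.
Proof.
move=> trX trY xy.
have xley : stab x `<=` stab y by rewrite xy.
have ylex : stab y `<=` stab x by rewrite xy.
have map_ex z : exists w, forall s, act s x = Some z -> act s y = Some w.
  have [s sx] := trX x z; have [w sy] := act_transfer trX xley sx.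
  by exists w => u ux; rewrite -sy; apply: act_transfer_eq ux sx.
have inv_ex w : exists z, forall s, act s y = Some w -> act s x = Some z.
  have [s sy] := trY y w; have [z sx] := act_transfer trY ylex sy.
  by exists z => u uy; rewrite -sx; apply: act_transfer_eq uy sy.
have [f fP] := choice map_ex; have [g gP] := choice inv_ex.
exists f.
  exists g => [z|w].
    by have [s sx] := trX x z; move: (gP _ _ (fP _ _ sx)); rewrite sx => -[].
  by have [s sy] := trY y w; move: (fP _ _ (gP _ _ sy)); rewrite sy => -[].
move=> s z; have [t tx] := trX x z; have ty := fP _ _ tx.
have mapP v : act s z = Some v -> act s (f z) = Some (f v).
  move=> sz; rewrite -(act_comp s ty); apply: fP.
  by rewrite (act_comp s tx).
split=> //; split=> /domP[v sv]; apply/domP; first by exists (f v); apply: mapP.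
exists (g v); rewrite -(act_comp s tx); apply: gP.
by rewrite (act_comp s ty).
Qed.

(** * The Wagner-Preston action *)

Section WagnerPrestonTheory.
Variable S : semigroupType.
Hypothesis hE : semilattice_idempotents S.
Implicit Types (e f g s x : S).

Lemma sle_idempotents g f : idempotents S g -> idempotents S f ->
  sle g f <-> f * g = g.
Proof.
move=> gg ff; split=> [[->//|[h [_ [_ _ -> _]]]]|fg].
  by rewrite mulgA ff.
right; exists g, g; split=> //.
by rewrite -{1}fg; case: (hE ff gg).
Qed.

Variable iS : inhabited S.
Let WP := wagner_preston hE iS.

Lemma wp_idem_dom f x : idempotents S f -> dom f (x : WP) <-> f * x = x.
Proof.
move=> ff; split=> [/domP[y fx]|fx].
  by rewrite -[RHS](act_idempotent ff fx); case/wp_opP: fx.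
apply/domP; exists x; apply/wp_opP; split=> //; exists f => /=.
  by rewrite /weak_inverses /= !ff.
by rewrite ff.
Qed.

Section RegularPoint.
Variables x x' : S.
Hypothesis xx'x : x * x' * x = x.

Lemma regular_idempotent : idempotents S (x * x').
Proof. by rewrite /idempotents /= mulgA xx'x. Qed.

(** An idempotent [f] is defined at [x] iff [f x = x], iff [f (x x') = x x']. *)
Lemma wp_idem_domP f : idempotents S f ->
  dom f (x : WP) <-> sle (x * x') f.
Proof.
move=> ff; rewrite (wp_idem_dom x ff) (sle_idempotents regular_idempotent ff).
by split=> h; [rewrite mulgA h | rewrite -{1}xx'x mulgA h xx'x].
Qed.

(** If [s] fixes [x = s' s x], then [g = x x'] satisfies [g = s g] and also
    [g = (g s') s], with [g s'] idempotent since [s' (s g) = g]. *)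
Lemma wp_stab_sub_omega : stab (x : WP) `<=` omega (idem_at (x : WP)).
Proof.
move=> s /wp_opP [[s' hs' s'sx] sx].
have gg := regular_idempotent; set g := x * x' in gg *.
have sg : s * g = g by rewrite /g mulgA sx.
have s'sE : idempotents S (s' * s) by rewrite /idempotents /= mulgA hs'.
have s'g : s' * g = g by rewrite -[in LHS]sg /g !mulgA -s'sx.
have gs's : g * (s' * s) = g.
  by case: (hE s'sE gg) => _ <-; rewrite -mulgA sg.
exists g; first by split=> //; apply/wp_idem_dom.
right; exists g, (g * s'); split=> //; last by rewrite -mulgA gs's.
by rewrite /idempotents /= mulgA -(mulgA g s') s'g gg.
Qed.

End RegularPoint.

Lemma L_class_left_inverse e x : idempotents S e -> L_class e x ->
  x * e = x /\ exists u, u * x = e.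
Proof.
move=> ee Lx; have LxE : principal_left x = principal_left e := Lx; split.
  have : principal_left x x by left.
  by rewrite LxE => -[->|[t ->]] //; rewrite -mulgA ee.
have : principal_left e e by left.
by rewrite -LxE => -[<-|[u ->]]; [exists e | exists u].
Qed.

(** Points of [L_e] are reached from [e] by acting with themselves: if
    [u x = e] and [x e = x], then [e u] is a weak inverse of [x] with
    [e u x e = e]. *)
Lemma wp_orbit_L_class e : idempotents S e -> orbit (e : WP) = L_class e.
Proof.
move=> ee; apply/seteqP; split=> x.
  case=> [[s se]|->]; last by [].
  by apply: (L_class_closed _ se).
move=> Lx; have [xe [u ux]] := L_class_left_inverse ee Lx.
left; exists x; apply/wp_opP; split=> //; exists (e * u).
  by rewrite /weak_inverses /= -(mulgA e u x) ux ee mulgA ee.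
by rewrite -(mulgA e u x) ux !ee.
Qed.

Lemma wp_orbit_regular e x : idempotents S e -> orbit (e : WP) x ->
  exists x', x * x' * x = x.
Proof.
move=> ee; rewrite (wp_orbit_L_class ee).
move=> /(L_class_left_inverse ee) [xe [u ux]].
by exists u; rewrite -mulgA ux.
Qed.

End WagnerPrestonTheory.

Section WagnerPrestonOrbit.
Variables (S : semigroupType) (hE : semilattice_idempotents S) (e : S).
Hypothesis ee : idempotents S e.
Let WP := wagner_preston hE (inhabits e).
Let Se := wp_orbit hE e.

Lemma wp_orbit_point_regular (x : Se) : exists x', val x * x' * val x = val x.
Proof. by apply: (@wp_orbit_regular _ hE (inhabits e) e) => //; apply: set_valP. Qed.

Lemma wp_orbit_transitive : transitive_act Se.
Proof.
have /domP[y ey] : dom e (e : WP) by apply/wp_idem_dom.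
by apply: (@orbit_act_transitive _ _ e); rewrite ey (act_idempotent ee ey).
Qed.

Lemma wp_orbit_locally_free : locally_free Se.
Proof.
move=> x; apply/seteqP; split; last exact: omega_idem_at_sub_stab.
rewrite stab_subact idem_at_subact.
by have [x'] := wp_orbit_point_regular x; apply: wp_stab_sub_omega.
Qed.

Lemma wp_orbit_graded : graded Se.
Proof.
have [q qP] := choice wp_orbit_point_regular.
exists (fun x => val x * q x); split=> [x|f ff].
  exact: regular_idempotent.
by apply/seteqP; split=> x; rewrite dom_subact (wp_idem_domP _ _ (qP x) ff).
Qed.

Lemma wp_orbit_iso_L_act : act_iso Se (L_act hE e).
Proof. exact/subact_iso_eq/wp_orbit_L_class. Qed.

End WagnerPrestonOrbit.

(** * The classification *)

Theorem theorem2p23 (S : semigroupType) (dS : E_dense S)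
    (hE : semilattice_idempotents S) :
  (forall (X : edense_act S) (p : X -> S),
      locally_free X -> transitive_act X -> is_grading p ->
      exists e : S,
        [/\ idempotents S e,
            act_iso X (wp_orbit hE e) &
            act_iso (wp_orbit hE e) (L_act hE e)]) /\
  (forall e : S, idempotents S e ->
      [/\ locally_free (wp_orbit hE e),
          transitive_act (wp_orbit hE e) &
          graded (wp_orbit hE e)]).
Proof.
split=> [X p lfX trX [pE domE]|e ee]; last first.
  by split; [exact: wp_orbit_locally_free | exact: wp_orbit_transitive
            | exact: wp_orbit_graded].
have [x] := act_inhabited X; have ee := pE x.
exists (p x); split=> //; last exact: wp_orbit_iso_L_act.
have e_in : p x \in orbit (p x : wagner_preston hE (inhabits (p x))).
  by rewrite inE; right.
pose y : wp_orbit hE (p x) := exist _ (p x) e_in.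
apply: (@transitive_stab_iso _ _ _ x y) => //; first exact: wp_orbit_transitive.
rewrite lfX (wp_orbit_locally_free ee); congr omega.
(* Both sides consist of the idempotents above [p x]; for [p x] as a point of
   its own orbit, [wp_idem_domP] applies with [x' = p x]. *)
rewrite idem_at_subact.
have domX f : idempotents S f -> dom f x <-> sle (p x) f by move=> /domE ->.
have eee : p x * p x * p x = p x by rewrite !ee.
have domS f : idempotents S f ->
    dom f (p x : wagner_preston hE (inhabits (p x))) <-> sle (p x) f.
  by move=> ff; rewrite (wp_idem_domP _ _ eee ff) ee.
apply/seteqP; split=> f [ff fx]; split=> //.
  exact/domS/domX.
exact/domX/domS.
Qed.
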